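(* Let $G$ be a finite group, $p$ a prime dividing $|G|$, $P\in\mathrm{Syl}_p(G)$ and $\Omega=\Omega_1(Z(P))$. If $r_p(G)-r_p(\Omega)\le2$ and $r_p(G)\ge\log_p(|P|)-1$, then $\mathcal{A}_p(G)'/G$ is a contractible finite space.
   Context: $\Omega_1(H)$ is the subgroup generated by the elements of order $p$ of $H$; $r_p(H)$ is the largest $r$ such that $H$ has an elementary abelian subgroup of order $p^r$. $\mathcal{A}_p(G)$ is the poset of non-trivial elementary abelian $p$-subgroups of $G$, with $G$ acting by conjugation; $\mathcal{A}_p(G)'$ is its poset of non-empty chains ordered by inclusion, with componentwise action; $\mathcal{A}_p(G)'/G$ is the orbit poset ($\overline{c}\le\overline{d}$ iff some representatives satisfy $c_1\subseteq d_1$), regarded as a finite $T_0$ space whose open sets are the down-sets. *)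

(* Defs.v *)
From HB Require Import structures.
From mathcomp Require Import all_boot all_order all_algebra all_fingroup all_solvable.
From mathcomp Require Import all_classical all_reals.
From mathcomp Require Import topology.
From mathcomp Require Import Rstruct Rstruct_topology.
From Stdlib Require Import Rdefinitions.

Set Implicit Arguments.
Unset Strict Implicit.
Unset Printing Implicit Defensive.

Import GroupScope.

Definition downset {T : Type} (le : T -> T -> bool) (A : set T) : Prop :=
  forall x y, A y -> le x y -> A x.

Definition alexandrov {T : choiceType} (le : T -> T -> bool) : Type := T.

Section Alexandrov.
Context {T : choiceType} (le : T -> T -> bool).
Local Open Scope classical_set_scope.

Let opT : downset le setT. Proof. by []. Qed.
Let opI : setI_closed (downset le).
Proof. by move=> A B hA hB x y [Ay By] lexy; split; [exact: hA Ay lexy|exact: hB By lexy]. Qed.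
Let op_bigU (I : Type) (f : I -> set T) :
  (forall i, downset le (f i)) -> downset le (\bigcup_i f i).
Proof. by move=> hf x y [i _ fiy] lexy; exists i => //; exact: hf fiy lexy. Qed.

HB.instance Definition _ := Choice.on (alexandrov le).
HB.instance Definition _ :=
  isOpenTopological.Build (alexandrov le) opT opI op_bigU.
End Alexandrov.

Local Open Scope ring_scope.
Definition contractible (X : topologicalType) : Prop :=
  exists (x0 : X) (H : X * R -> X),
    {within [set xt : X * R | (0 <= xt.2 <= 1)%R], continuous H}%classic /\
    (forall x, H (x, 0%R) = x) /\ (forall x, H (x, 1%R) = x0).
Local Close Scope ring_scope.

Section Ap.
Variables (gT : finGroupType) (G : {group gT}) (p : nat).

Definition Ap : {set {group gT}} :=
  [set E : {group gT} | (E \in 'E_p(G)) && (E :!=: 1)].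

Definition Ap_chains : {set {set {group gT}}} :=
  [set c : {set {group gT}} | [&& c \subset Ap, c != finset.set0 &
     [forall E in c, forall F in c, (E \subset F) || (F \subset E)]]].

Definition conj_chain (c : {set {group gT}}) (x : gT) : {set {group gT}} :=
  [set (E :^ x)%G | E in c].

Definition chain_orbit (c : {set {group gT}}) : {set {set {group gT}}} :=
  [set conj_chain c x | x in G].

Definition Ap_orbits : {set {set {set {group gT}}}} :=
  [set chain_orbit c | c in Ap_chains].

Definition ApOrb : Type := {O : {set {set {group gT}}} | O \in Ap_orbits}.
HB.instance Definition _ := Choice.on ApOrb.

Definition ApOrb_le (O1 O2 : ApOrb) : bool :=
  [exists c in val O1, exists d in val O2, c \subset d].

Definition Ap_orbit_space : topologicalType := alexandrov ApOrb_le.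
End Ap.

(* Main.v *)
(**
  Every chain c of elementary abelian p-subgroups of G admits an adapted Sylow
  subgroup P, one for which C_P(E) is Sylow in C_G(E) for every E in c; a P
  adapted to c is adapted to the subchains of c.  Call E p-central if C_G(E)
  contains a Sylow subgroup of G, and let c_cen be the set of p-central members
  of c, S the set of the C_P(E) for the other members E, and Omega the group
  Ohm_1(Z(P)).  The fence
    c <= c + S >= c_cen + S <= c_cen + S + {Omega} >= {Omega}
  consists of monotone maps of the orbit poset, provided that, up to conjugacy,
  its terms do not depend on P; it then contracts the orbit poset to a point.

  The rank hypotheses say that a nonabelian P has an elementary abelian subgroup
  A of index p, with |P : Z(P)| <= p^3.  For E not central in P, C_P(E) is A or
  Z(P)E according to whether E lies in A; hence S is at most a singleton, made
  of an elementary abelian group.  If P and Q are adapted to c and share the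
  same S = {K}, then N_P(K) and N_Q(K) are Sylow subgroups of the normaliser of
  K in C_G(c_cen), with centers Z(P) and Z(Q), so a conjugation in that
  normaliser carries Omega for P to Omega for Q.
*)
Require Import Defs.
From mathcomp Require Import all_classical all_reals topology normedtype.
From mathcomp Require Import Rstruct Rstruct_topology.
From mathcomp Require Import all_boot all_order all_algebra all_fingroup all_solvable.

Set Implicit Arguments.
Unset Strict Implicit.
Unset Printing Implicit Defensive.

(** * Contractibility of Alexandrov spaces *)

Section Fence.
Import Order.TTheory GRing.Theory Num.Theory.
Local Open Scope classical_set_scope.
Local Open Scope ring_scope.

Lemma nbhs_alexandrov (T : choiceType) (le : rel T) (x : alexandrov le)
    (B : set (alexandrov le)) :
  reflexive le -> transitive le -> nbhs x B <-> [set y | le y x] `<=` B.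
Proof.
move=> lexx letr; split=> [|sB].
  rewrite nbhsE => -[U [oU Ux] sUB] y /= lyx; apply: sUB.
  exact: (oU y x Ux lyx).
rewrite nbhsE; exists [set y | le y x] => //; split; last exact: lexx.
by move=> y z /= lzx lyz; apply: letr lyz lzx.
Qed.

(** The homotopy passes through the identity, [f1], [f2], [f3] and the constant [x0]. It is
    continuous because its values at the instants [a] and [b] dominate those at neighbouring
    times. *)
Lemma contractible_fence (T : choiceType) (le : rel T) (x0 : T)
    (f1 f2 f3 : T -> T) :
  reflexive le -> transitive le ->
  {homo f1 : x y / le x y} -> {homo f2 : x y / le x y} ->
  {homo f3 : x y / le x y} ->
  (forall x, le x (f1 x)) -> (forall x, le (f2 x) (f1 x)) ->
  (forall x, le (f2 x) (f3 x)) -> (forall x, le x0 (f3 x)) ->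
  contractible (alexandrov le).
Proof.
move=> lexx letr h1 h2 h3 le01 le21 le23 le43.
pose a : Rdefinitions.R := 3^-1; pose b : Rdefinitions.R := 2 * a.
have a0 : 0 < a by rewrite invr_gt0.
have ab : a < b by rewrite /b mulr_natl mulr2n ltrDl.
have b1 : b < 1 by rewrite /b /a ltr_pdivrMr // mul1r ltr_nat.
(* Open sets are down-sets: the larger maps of the fence get isolated times. *)
pose H (xt : T * Rdefinitions.R) : T := let: (x, t) := xt in
  if t < a then x else if t == a then f1 x else
  if t < b then f2 x else if t == b then f3 x else x0.
exists (x0 : alexandrov le), (H : alexandrov le * Rdefinitions.R -> alexandrov le).
split; last first.
  split=> x /=; first by rewrite a0.
  have a1 := lt_trans ab b1.
  by rewrite !ltNge (ltW a1) (ltW b1) /= (gt_eqF a1) (gt_eqF b1).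
apply: continuous_subspaceT => -[x t] B /(nbhs_alexandrov _ _ lexx letr) sB.
have nx : nbhs (x : alexandrov le) [set y | le y x] by apply/nbhs_alexandrov.
(* The down-set of [x] is its least neighbourhood, so only the neighbourhood [V] of [t] remains to
   be chosen. *)
suff [V nV HV] : exists2 V : set Rdefinitions.R, nbhs t V &
    forall y s, le y x -> V s -> le (H (y, s)) (H (x, t)).
  by exists ([set y | le y x], V) => //= -[y s] /= [yx Vs]; apply/sB/HV.
rewrite /H; case: (ltrgtP t a) => [ta|ta|->].
- exists [set s | s < a] => [|y s yx /= -> //].
  by apply: open_nbhs_nbhs; split => //; apply: open_lt.
- case: (ltrgtP t b) => [tb|tb|->].
  + exists ([set s | a < s] `&` [set s | s < b]) => [|y s yx /= [sa sb]].
      by apply: filterI; apply: open_nbhs_nbhs; split => //; do ?[exact: open_gt|exact: open_lt].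
    by rewrite ltNge ltW //= gt_eqF // sb h2.
  + exists [set s | b < s] => [|y s yx /= sb].
      by apply: open_nbhs_nbhs; split => //; apply: open_gt.
    by have sa := lt_trans ab sb; rewrite ltNge ltW // gt_eqF // ltNge ltW //= gt_eqF.
  (* Times beyond [a] give [f2 y], [f3 y] or [x0], all below [f3 y]. *)
  + exists [set s | a < s] => [|y s yx /= sa].
      by apply: open_nbhs_nbhs; split => //; apply: open_gt.
    rewrite ltNge ltW // gt_eqF //; apply: letr (h3 _ _ yx).
    by case: ltrgtP => // *; rewrite lexx.
- exists [set s | s < b] => [|y s yx /= sb].
    by apply: open_nbhs_nbhs; split => //; apply: open_lt.
  apply: letr (h1 _ _ yx); rewrite sb.
  by case: ltrgtP => // *; rewrite lexx.
Qed.

End Fence.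

Import GroupScope.

(** * p-groups with an elementary abelian maximal subgroup *)

Section AbelemMaximal.
Variables (gT : finGroupType) (p : nat) (P A : {group gT}).
Hypotheses (p_pr : prime p) (pP : p.-group P) (abA : p.-abelem A).
Hypotheses (sAP : A \subset P) (iPA : #|P : A| = p) (nabP : ~~ abelian P).

Let maxA : maximal A P. Proof. by rewrite p_index_maximal ?iPA. Qed.
Let nAP : A <| P. Proof. exact: p_maximal_normal pP maxA. Qed.

(** Otherwise [P = A * 'Z(P)] by maximality, and this product is abelian. *)
Lemma center_sub_abelem_max : 'Z(P) \subset A.
Proof.
apply: contraR nabP => nZA.
rewrite -(mulg_normal_maximal nAP maxA (center_sub P) nZA) abelianM.
by rewrite (abelem_abelian abA) center_abelian /= subIset // centS ?orbT.
Qed.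

(** Here [P = A * E] with [A] abelian, so what commutes with [E] inside [A] is central in [P]. *)
Lemma abelem_max_cap_cent (E : {group gT}) :
  E \subset P -> ~~ (E \subset A) -> 'C_A(E) = 'Z(P).
Proof.
move=> sEP nEA; apply/eqP; rewrite eqEsubset !subsetI center_sub_abelem_max.
rewrite (subset_trans (subsetIl A _) sAP) /= -{1}(mulg_normal_maximal nAP maxA sEP nEA).
rewrite centM subsetI subsetIr andbT subIset ?[A \subset _](abelem_abelian abA) //=.
by rewrite subIset // centS ?orbT.
Qed.

(** Dedekind's modular law for [P = A * E] and [E \subset 'C(E)]. *)
Lemma abelem_max_cent_mul (E : {group gT}) :
  E \subset P -> abelian E -> ~~ (E \subset A) -> 'C_P(E) = 'Z(P) * E.
Proof.
move=> sEP cEE nEA; rewrite -(abelem_max_cap_cent sEP nEA).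
by rewrite ['C_A(E)]setIC group_modr // setIC (mulg_normal_maximal nAP maxA sEP nEA).
Qed.

Lemma abelem_max_cent_id (E : {group gT}) :
  E \subset A -> ~~ (P \subset 'C(E)) -> 'C_P(E) = A.
Proof.
move=> sEA ncEP; have [_ max] := maxgroupP maxA.
apply: max => /=.
  by rewrite properE subsetIl subsetI subxx.
by rewrite subsetI sAP (subset_trans (abelem_abelian abA) (centS sEA)).
Qed.

(** * Centralisers of non-central elementary abelian subgroups *)

Variable E : {group gT}.
Hypotheses (abE : p.-abelem E) (sEP : E \subset P) (ncEP : ~~ (P \subset 'C(E))).

(** The centraliser is [A] if [E \subset A], and otherwise the central product of ['Z(P)] and
    [E]. *)
Lemma abelem_cent : p.-abelem 'C_P(E).
Proof.
have [sEA|nEA] := boolP (E \subset A); first by rewrite abelem_max_cent_id.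
have defC := abelem_max_cent_mul sEP (abelem_abelian abE) nEA.
rewrite (cprod_abelem p (_ : 'Z(P) \* E = 'C_P(E))) ?abE ?andbT.
  exact: abelemS center_sub_abelem_max abA.
by rewrite cprodE ?defC // centsC subIset // centS ?orbT.
Qed.

Lemma cent_cap_abelem_max : ~~ (E \subset A) -> 'C_P(E) :&: A = 'Z(P).
Proof. 
move=> nEA; rewrite -(abelem_max_cap_cent sEP nEA) setIAC; congr (_ :&: _).
by apply/setIidPr.
Qed.

(** Since [P = A * 'C_P(E)] and the factors meet in ['Z(P)], this index equals [#|P : A|]. *)
Lemma index_center_cent : ~~ (E \subset A) -> #|'C_P(E) : 'Z(P)| = p.
Proof.
move=> nEA; rewrite -(cent_cap_abelem_max nEA) indexgI -iPA -indexMg.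
rewrite (mulg_normal_maximal nAP maxA (subsetIl _ _)) //.
apply: contra nEA => /(subset_trans _)-> //.
by rewrite subsetI sEP; apply: abelem_abelian abE.
Qed.

Hypothesis iPZ : logn p #|P : 'Z(P)| <= 3.

Let S := 'C_P(E)%G.

Let sES : E \subset S.
Proof. by rewrite subsetI sEP; apply: abelem_abelian abE. Qed.
Let sZS : 'Z(P) \subset S.
Proof. by rewrite subsetI center_sub subIset // centS ?orbT. Qed.
Let cPS : 'C_P(S) \subset S.
Proof. by rewrite setIS ?centS. Qed.

Let prSP : S \proper P.
Proof. by rewrite properE subsetIl subsetI subxx. Qed.
Let prSN : S \proper 'N_P(S).
Proof. exact: nilpotent_proper_norm (pgroup_nil pP) prSP. Qed.
Let sSN : S \subset 'N_P(S). Proof. exact: proper_sub. Qed.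

Let not_sEA : ~~ (P \subset 'N(S)) -> ~~ (E \subset A).
Proof.
by apply: contra => sEA; rewrite /= (abelem_max_cent_id sEA ncEP) normal_norm.
Qed.

(* The right-hand side depends only on #|S| and on the isomorphism type of P:
   this makes #|'N_P(S)| the same for all the Sylow subgroups with that S. *)
Lemma index_norm_cent :
  #|P : 'N_P(S)| =
    if (#|P : S| == p) || (P^`(1) \subset 'Z(P)) then 1%N else p.
Proof.
case: ifP => [iS | /norP[iS dP]].
  apply/eqP; rewrite indexg_eq1 subsetI subxx /=; case/orP: iS => [/eqP iS|dP].
    by rewrite normal_norm // (p_maximal_normal pP) ?p_index_maximal ?iS ?subsetIl.
  by rewrite normal_norm // sub_der1_normal ?subsetIl ?(subset_trans dP).
have nEA : ~~ (E \subset A).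
  by apply: contra iS => sEA; rewrite /= (abelem_max_cent_id sEA ncEP) iPA.
have lPS : logn p #|P : S| <= 2.
  move: iPZ; rewrite -(Lagrange_index (subsetIl P 'C(E)) sZS) lognM ?indexg_gt0 //.
  by rewrite index_center_cent // (logn_prime p p_pr) eqxx addn1.
(* If [S] were normal, [P / S] and [P / A], of order at most p^2, would be abelian, and the derived
   subgroup would lie in [S :&: A = 'Z(P)]. *)
have nNS : ~~ (P \subset 'N(S)).
  apply: contra dP => nSP; rewrite -(cent_cap_abelem_max nEA) subsetI.
  have abQ (H : {group gT}) : P \subset 'N(H) -> logn p #|P : H| <= 2 -> abelian (P / H).
    by move=> nHP lH; apply: (@p2group_abelian _ p); rewrite ?quotient_pgroup ?card_quotient.
  rewrite (der1_min nSP) ?abQ // der1_min ?normal_norm ?abQ ?normal_norm //.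
  by rewrite iPA (logn_prime p p_pr) eqxx.
have pPN : p.-nat #|P : 'N_P(S)| by rewrite (pnat_dvd (dvdn_indexg _ _)).
have pNS : p.-nat #|'N_P(S) : S|.
  exact: pnat_dvd (dvdn_indexg _ _) (pgroupS (subsetIl P 'N(S)) pP).
(* The indices of ['N_P(S)] in [P] and of [S] in ['N_P(S)] both exceed 1, and their product is at
   most p^2. *)
have : 1 < #|'N_P(S) : S|.
  by rewrite indexg_gt1 proper_subn.
have : 1 < #|P : 'N_P(S)| by rewrite indexg_gt1 subsetI subxx.
move: lPS; rewrite -(Lagrange_index (subsetIl P 'N(S)) sSN) lognM ?indexg_gt0 //.
have [[|[|m]] ->] := p_natP pPN; have [[|[|n]] ->] := p_natP pNS => //;
  by rewrite !pfactorK // !addnS.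
Qed.

(** If [S] is not normal, ['Z('N_P(S))] lies between ['Z(P)] and [S], where the index is p. It is
    not [S], since otherwise ['N_P(S)] would centralise [S] and so lie in it. *)
Lemma center_norm_cent : 'Z('N_P(S)) = 'Z(P).
Proof.
have [nSP | nNS] := boolP (P \subset 'N(S)); first by rewrite (setIidPl nSP).
have sZN : 'Z(P) \subset 'Z('N_P(S)).
  rewrite subsetI (subset_trans sZS) ?subsetI ?normG ?subsetIl //.
  by rewrite subIset // centS ?subsetIl ?orbT.
have sZNS : 'Z('N_P(S)) \subset S.
  apply: subset_trans cPS; rewrite subsetI.
  by rewrite (subset_trans (center_sub _)) ?subsetIl // subIset // (centS sSN) orbT.
apply/eqP; rewrite eqEsubset sZN andbT.
have maxZ : maximal 'Z(P) S.
  by rewrite p_index_maximal // index_center_cent ?not_sEA.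
have [_ max] := maxgroupP maxZ.
have [prZ|] := boolP ('Z('N_P(S)) \proper S); first by rewrite (max _ prZ).
rewrite properE sZNS negbK => sSZ; have /negP[] := proper_subn prSN.
by apply: subset_trans cPS; rewrite subsetI subsetIl centsC (subset_trans sSZ) ?subsetIr.
Qed.

End AbelemMaximal.

(** * Sylow subgroups: conjugacy of centers, ranks, adaptation to chains *)

Lemma centerJ (gT : finGroupType) (H : {group gT}) (x : gT) :
  'Z(H :^ x) = 'Z(H) :^ x.
Proof. by rewrite /center centJ conjIg. Qed.

(** The normalisers of ['C_P(E)] in [P] and [Q] are Sylow in ['N_C('C_P(E))], hence conjugate there,
    and their centers are ['Z(P)] and ['Z(Q)]. *)
Lemma conj_center_Sylow (gT : finGroupType) (p : nat) (C P Q A E : {group gT}) :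
    prime p -> p.-Sylow(C) P -> p.-Sylow(C) Q ->
    p.-abelem A -> A \subset P -> #|P : A| = p -> ~~ abelian P ->
    logn p #|P : 'Z(P)| <= 3 ->
    p.-abelem E -> E \subset P -> ~~ (P \subset 'C(E)) ->
    p.-Sylow('C_C(E)) 'C_P(E) -> 'C_Q(E) = 'C_P(E) ->
  exists2 h, h \in 'N_C('C_P(E)) & 'Z(Q) = 'Z(P) :^ h.
Proof.
move=> p_pr sylP sylQ abA sAP iPA nabP iPZ abE sEP ncEP sylS eqS.
pose S := 'C_P(E)%G; have cEE := abelem_abelian abE.
have sES : E \subset S by rewrite subsetI sEP.
(* [R] is conjugate to [P] and shares [S] with it, so the formula for the index of the normaliser
   gives the same value for both. *)
have key (R : {group gT}) : p.-Sylow(C) R -> 'C_R(E) = S ->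
    'Z('N_R(S)) = 'Z(R) /\ #|'N_R(S)| = #|'N_P(S)|.
  move=> sylR eqRS; have [g Cg defR] := Sylow_trans sylP sylR.
  have [pP pR] := (pHall_pgroup sylP, pHall_pgroup sylR).
  have cardR : #|R| = #|P| by rewrite defR cardJg.
  have sER : E \subset R by rewrite (subset_trans sES) // -eqRS subsetIl.
  have ncER : ~~ (R \subset 'C(E)).
    apply: contra ncEP => cER; have /eqP defS : S == P :> {set gT}.
      by rewrite eqEcard subsetIl -cardR -(setIidPl cER) eqRS leqnn.
    by rewrite -defS subsetIr.
  have sAgR : A :^ g \subset R by rewrite defR conjSg.
  have iR : #|R : A :^ g| = p by rewrite defR indexJg.
  have nabR : ~~ abelian R by rewrite defR abelianJ.
  have iRZ : logn p #|R : 'Z(R)| <= 3 by rewrite defR centerJ indexJg.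
  have abAg : p.-abelem (A :^ g) by rewrite abelemJ.
  have := center_norm_cent p_pr pR abAg sAgR iR nabR abE sER ncER.
  have := index_norm_cent p_pr pR abAg sAgR iR nabR abE sER ncER iRZ.
  have := index_norm_cent p_pr pP abA sAP iPA nabP abE sEP ncEP iPZ.
  rewrite /= eqRS -/S => iNP iNR ->; split=> //; apply/eqP.
  have sSR : S \subset R by rewrite -eqRS subsetIl.
  have eqi : #|R : 'N_R(S)| = #|P : 'N_P(S)|.
    rewrite iNR iNP -!divgS ?subsetIl //= cardR.
    by rewrite [in R^`(1)]defR [in 'Z(R)]defR centerJ derJ conjSg.
  by rewrite -(eqn_pmul2r (indexg_gt0 P 'N_P(S))) -{1}eqi !Lagrange ?subsetIl ?cardR.
have nSylow (R : {group gT}) : p.-Sylow(C) R -> 'C_R(E) = S ->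
    p.-Sylow('N_C(S)) 'N_R(S).
  move=> sylR eqRS; have pR := pHall_pgroup sylR.
  have sNR : 'N_R(S) \subset 'N_C(S) by rewrite setSI // (pHall_sub sylR).
  (* A Sylow subgroup [T] of ['N_C(S)] above ['N_R(S)] lies in a Sylow subgroup [U] of [C]. As [S]
     is Sylow in ['C_C(E)], also ['C_U(E) = S], so [T] is no larger than ['N_R(S)]. *)
  have [T sylT sNT] := Sylow_superset sNR (pgroupS (subsetIl _ _) pR).
  have [sTN pT _] := and3P sylT.
  have [sTC nST] : T \subset C /\ T \subset 'N(S) by apply/andP; rewrite -subsetI.
  have [U sylU sTU] := Sylow_superset sTC pT.
  have sSU : S \subset U.
    by rewrite (subset_trans _ sTU) // (subset_trans _ sNT) // subsetI normG -eqRS subsetIl.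
  have eqUS : 'C_U(E) = S.
    apply: (sub_pHall sylS); rewrite ?(pgroupS (subsetIl _ _) (pHall_pgroup sylU)) //.
      by rewrite subsetI sSU subsetIr.
    by rewrite setSI // (pHall_sub sylU).
  have [_ cU] := key U sylU eqUS; have [_ cR] := key R sylR eqRS.
  rewrite (_ : 'N_R(S) = T) //; apply/eqP.
  by rewrite eqEcard sNT cR -cU subset_leq_card // subsetI sTU.
have [h Nh eqN] := Sylow_trans (nSylow P sylP erefl) (nSylow Q sylQ eqS).
exists h => //; have [<- _] := key Q sylQ eqS; have [<- _] := key P sylP erefl.
by rewrite eqN centerJ.
Qed.

(** Take [A] of maximal rank: the second bound gives index at most p, and index 1 would make [P]
    abelian. Then ['Z(P)] lies in [A], so the first bound reads [#|A : 'Z(P)| <= p^2]. *)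
Lemma abelem_max_of_rank (gT : finGroupType) (p : nat) (G P : {group gT}) :
    prime p -> p.-Sylow(G) P -> ~~ abelian P ->
    'r_p(G) - 'r_p('Ohm_1('Z(P))) <= 2 -> logn p #|P| - 1 <= 'r_p(G) ->
  exists A : {group gT},
    [/\ p.-abelem A, A \subset P, #|P : A| = p & logn p #|P : 'Z(P)| <= 3].
Proof.
move=> p_pr sylP nabP; rewrite -(p_rank_Sylow sylP) p_rank_Ohm1.
have pP := pHall_pgroup sylP.
have [A /pnElemP[sAP abA <-]] := p_rank_witness p P => rZ rP.
have iPA : #|P : A| = p.
  have : 1 < #|P : A|.
    by rewrite indexg_gt1; apply: contra nabP => /abelianS-> //; apply: abelem_abelian abA.
  have : logn p #|P : A| <= 1.
    move: rP; rewrite -(Lagrange sAP) lognM ?indexg_gt0 ?cardG_gt0 //.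
    by rewrite leq_subLR [(1 + _)%N]addnC leq_add2l.
  have [n ->] := p_natP (pnat_dvd (dvdn_indexg P A) pP).
  by rewrite pfactorK //; case: n => [|[]].
exists A; split=> //; have sZA := center_sub_abelem_max p_pr pP abA sAP iPA nabP.
move: rZ; rewrite (p_rank_abelem (abelemS sZA abA)) leq_subLR => rZ.
rewrite -(Lagrange_index sAP sZA) lognM ?indexg_gt0 // iPA (logn_prime p p_pr) eqxx.
rewrite add1n ltnS -(leq_add2l (logn p #|'Z(P)|)) -lognM ?indexg_gt0 ?cardG_gt0 //.
by rewrite Lagrange.
Qed.

(** Induction on [#|c|]: remove the least member [E], find an adapted Sylow subgroup of ['C_H(E)],
    and enlarge it to one of [H]. Larger members [F] satisfy ['C_H(F) \subset 'C_H(E)]. *)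
Lemma exists_Sylow_adapted (gT : finGroupType) (p : nat) (H : {group gT})
    (c : {set {group gT}}) :
  {in c &, forall E F : {group gT}, (E \subset F) || (F \subset E)} ->
  exists2 P : {group gT}, p.-Sylow(H) P &
    {in c, forall E : {group gT}, p.-Sylow('C_H(E)) 'C_P(E)}.
Proof.
have [n] := ubnP #|c|; elim: n c H => // n IHn c H ltcn cc.
have [->|[E0 cE0]] := set_0Vmem c.
  by have [P sylP] := Sylow_exists p H; exists P => // E; rewrite inE.
have [E cE minE] := arg_minnP (fun E : {group gT} => #|E|) cE0.
have sE F : F \in c -> E \subset F.
  move=> cF; have /orP[//|sFE] := cc _ _ cE cF.
  by have /eqP-> : F == E :> {set gT} by rewrite eqEcard sFE minE.
have ltc : #|c :\ E| < n by move: ltcn; rewrite (cardsD1 E) (cE : E \in c).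
have [|Q sylQ adQ] := IHn (c :\ E) 'C_H(E)%G ltc.
  by move=> F K /setD1P[_ cF] /setD1P[_ cK]; apply: cc.
have [sQC pQ _] := and3P sylQ.
have [P sylP sQP] := Sylow_superset (subset_trans sQC (subsetIl _ _)) pQ.
have [sPH pP _] := and3P sylP.
have sup (F K : {group gT}) :
    p.-Sylow('C_H(F)) K -> K \subset P -> p.-Sylow('C_H(F)) 'C_P(F).
  move=> sylK sKP; rewrite (_ : 'C_P(F) = K) //.
  apply: (sub_pHall sylK); rewrite ?(pgroupS (subsetIl _ _) pP) ?setSI //.
  by rewrite subsetI sKP (subset_trans (pHall_sub sylK)) ?subsetIr.
exists P => // F cF; have [->|neF] := eqVneq F E; first exact: sup sylQ sQP.
have := adQ F; rewrite !inE neF cF => /(_ isT).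
rewrite /= -setIA (setIidPr (centS (sE F cF))) => sylF.
by apply: (sup _ _ sylF); apply: subset_trans (subsetIl _ _) sQP.
Qed.

(** * Maps of the orbit poset *)

Section OrbitMaps.
Variables (gT : finGroupType) (G : {group gT}) (p : nat).
Implicit Types (c d : {set {group gT}}) (P Q E F : {group gT}) (O : ApOrb G p).

Definition adapted c P :=
  p.-Sylow(G) P && [forall E in c, p.-Sylow('C_G(E)) 'C_P(E)].

Lemma adaptedP c P :
  reflect (p.-Sylow(G) P /\ {in c, forall E : {group gT}, p.-Sylow('C_G(E)) 'C_P(E)})
          (adapted c P).
Proof. by apply: (iffP andP) => -[sylP /forall_inP]. Qed.

(** This is the setwise conjugation action on groups, to which the general orbit lemmas apply. *)
Lemma conj_chainE c x : conj_chain c x = ('JG^*)%act c x.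
Proof. by []. Qed.

Lemma chain_orbitE c : chain_orbit G c = orbit ('JG^*)%act G c.
Proof. by []. Qed.

Lemma chain_orbitJ c x : x \in G -> chain_orbit G (conj_chain c x) = chain_orbit G c.
Proof. by move=> Gx; rewrite !chain_orbitE orbit_act. Qed.

Lemma Ap_conj E x : x \in G -> ((E :^ x)%G \in Ap G p) = (E \in Ap G p).
Proof.
move=> Gx; rewrite !inE /= abelemJ -{1}(conjGid Gx) conjSg; congr (_ && ~~ _).
by rewrite !trivg_card1 cardJg.
Qed.

Lemma Ap_chainsP c :
  reflect [/\ {subset c <= Ap G p}, exists E, E \in c &
            {in c &, forall E F : {group gT}, (E \subset F) || (F \subset E)}]
          (c \in Ap_chains G p).
Proof.
rewrite inE; apply: (iffP and3P) => -[/subsetP sc c0 tc]; split=> //.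
- by apply/set0Pn.
- by move=> E F cE cF; have /forall_inP/(_ E cE)/forall_inP/(_ F cF) := tc.
- by apply/set0Pn.
by apply/forall_inP=> E cE; apply/forall_inP=> F cF; apply: tc.
Qed.

Lemma conj_chain_Ap c x :
  x \in G -> c \in Ap_chains G p -> conj_chain c x \in Ap_chains G p.
Proof.
move=> Gx /Ap_chainsP[sc [E cE] tc]; apply/Ap_chainsP; split.
- by move=> _ /imsetP[F cF ->]; rewrite Ap_conj ?sc.
- by exists (E :^ x)%G; apply: imset_f.
by move=> _ _ /imsetP[F cF ->] /imsetP[K cK ->]; rewrite !conjSg tc.
Qed.

Lemma ApOrb_has_mem O : exists c, c \in val O.
Proof.
by case: O => O /imsetP[c _ /= ->]; exists c; rewrite chain_orbitE orbit_refl.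
Qed.

Lemma ApOrb_memE O c :
  c \in val O -> c \in Ap_chains G p /\ val O = chain_orbit G c.
Proof.
case: O => /= _ /imsetP[d chd ->] /imsetP[x Gx ->].
by rewrite chain_orbitJ // conj_chain_Ap.
Qed.

Lemma adaptedJ c P x :
  x \in G -> adapted c P -> adapted (conj_chain c x) (P :^ x)%G.
Proof.
move=> Gx /adaptedP[sylP ad]; apply/adaptedP; split.
  by rewrite -(conjGid Gx) pHallJ2.
move=> _ /imsetP[E cE ->] /=.
by rewrite -{1}(conjGid Gx) centJ -!conjIg pHallJ2 ad.
Qed.

Lemma adaptedS c d P : c \subset d -> adapted d P -> adapted c P.
Proof.
move=> /subsetP scd /adaptedP[sylP ad]; apply/adaptedP; split=> // E cE.
by apply: ad; apply: scd.
Qed.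

Lemma exists_adapted c : c \in Ap_chains G p -> exists P, adapted c P.
Proof.
case/Ap_chainsP=> _ _ /(exists_Sylow_adapted p G)[P sylP adP].
by exists P; apply/adaptedP.
Qed.

Lemma ApOrb_le_refl : reflexive (@ApOrb_le gT G p).
Proof.
move=> O; have [c Oc] := ApOrb_has_mem O.
by apply/exists_inP; exists c => //; apply/exists_inP; exists c.
Qed.

Lemma ApOrb_leP O1 O2 :
  reflect (exists c d, [/\ c \in val O1, d \in val O2 & c \subset d]) (ApOrb_le O1 O2).
Proof.
apply: (iffP exists_inP) => [[c Oc /exists_inP[d Od scd]]|[c [d [Oc Od scd]]]].
  by exists c, d.
by exists c => //; apply/exists_inP; exists d.
Qed.

Lemma ApOrb_le_trans : transitive (@ApOrb_le gT G p).
Proof.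
move=> O2 O1 O3 /ApOrb_leP[c [d [Oc Od scd]]] /ApOrb_leP[d' [e [Od' Oe sde]]].
have [_ defO1] := ApOrb_memE Oc; have [_ defO2] := ApOrb_memE Od.
move: Od'; rewrite defO2 => /imsetP[x Gx defd'].
apply/ApOrb_leP; exists (conj_chain c x), e; split=> //.
  by rewrite defO1 imset_f.
by apply: subset_trans sde; rewrite defd' imsetS.
Qed.

(** An equivariant construction [g], monotone in the chain and independent of the adapted Sylow
    subgroup up to conjugacy, descends to orbits. *)
Lemma orbit_map (g : {set {group gT}} -> {group gT} -> {set {group gT}}) :
    (forall c P x, x \in G -> g (conj_chain c x) (P :^ x)%G = conj_chain (g c P) x) ->
    (forall c P, c \in Ap_chains G p -> adapted c P -> g c P \in Ap_chains G p) ->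
    (forall c P Q, c \in Ap_chains G p -> adapted c P -> adapted c Q ->
       exists2 h, h \in G & g c Q = conj_chain (g c P) h) ->
    (forall c d P, c \subset d -> g c P \subset g d P) ->
  exists2 f : ApOrb G p -> ApOrb G p, {homo f : O1 O2 / ApOrb_le O1 O2} &
    forall O c P, c \in val O -> adapted c P -> g c P \in val (f O).
Proof.
move=> gJ gAp gU gS.
have [f fP] : {f : ApOrb G p -> ApOrb G p & forall O c P, c \in val O ->
    adapted c P -> g c P \in val (f O)}.
  apply: (choice (P := fun O O' => forall c P,
    c \in val O -> adapted c P -> g c P \in val O')) => O.
  have [c Oc] := ApOrb_has_mem O.
  have [chc defO] := ApOrb_memE Oc; have [P adP] := exists_adapted chc.
  have hO' : chain_orbit G (g c P) \in Ap_orbits G p by rewrite imset_f ?gAp.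
  exists (@exist _ (fun X => X \in Ap_orbits G p) _ hO') => d Q.
  rewrite defO => /imsetP[x Gx ->] adQ /=.
  have [h Gh ->] := gU _ _ _ (conj_chain_Ap Gx chc) (adaptedJ Gx adP) adQ.
  by rewrite gJ // !conj_chainE chain_orbitE -actM mem_orbit // groupM.
exists f => // O1 O2 /ApOrb_leP[c [d [Oc Od scd]]].
(* A [P] adapted to the larger chain [d] computes both values. *)
have [chd _] := ApOrb_memE Od; have [P adP] := exists_adapted chd.
apply/ApOrb_leP; exists (g c P), (g d P); split; last exact: gS.
  exact: fP Oc (adaptedS scd adP).
exact: fP Od adP.
Qed.

(** * p-central members of a chain and centralisers of the others *)

Definition pcentral E := (#|'C_G(E)| `_p == #|G| `_p)%N.

Lemma pcentralJ E x : x \in G -> pcentral (E :^ x)%G = pcentral E.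
Proof.
by move=> Gx; rewrite /pcentral /= -{1}(conjGid Gx) centJ -conjIg cardJg.
Qed.

Lemma pcentral_sub E F : E \subset F -> pcentral F -> pcentral E.
Proof.
move=> sEF /eqP cF; rewrite /pcentral eqn_dvd partn_dvd ?cardSg ?subsetIl //=.
by rewrite -cF partn_dvd ?cardSg ?setIS ?centS.
Qed.

Definition pcentrals c := [set E in c | pcentral E].

(** Kept as a set, empty when all members of [c] are p-central, so that it is visibly monotone in
    [c]. *)
Definition cents c P := [set 'C_P(E)%G | E : {group gT} in c :\: pcentrals c].

Definition Omega P := 'Ohm_1('Z(P))%G.

Lemma mem_cents c P E : E \in c -> ~~ pcentral E -> 'C_P(E)%G \in cents c P.
Proof. by move=> cE nE; apply/imsetP; exists E; rewrite // !inE cE (negPf nE). Qed.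

Lemma centsP c P K :
  reflect (exists E, [/\ E \in c, ~~ pcentral E & K = 'C_P(E)%G]) (K \in cents c P).
Proof.
apply: (iffP imsetP) => [[E]|[E [cE nE ->]]].
  by rewrite !inE => /andP[nE cE] ->; exists E; move: nE; rewrite cE.
by exists E; rewrite // !inE cE (negPf nE).
Qed.

Lemma conj_chainU c d x : conj_chain (c :|: d) x = conj_chain c x :|: conj_chain d x.
Proof. exact: imsetU. Qed.

Lemma mem_conj_chain c x E : ((E :^ x)%G \in conj_chain c x) = (E \in c).
Proof.
apply/imsetP/idP=> [[F cF /(congr1 val)/conjsg_inj/val_inj-> //]|cE].
by exists E.
Qed.

Lemma pcentralsJ c x : x \in G -> pcentrals (conj_chain c x) = conj_chain (pcentrals c) x.
Proof.
move=> Gx; apply/setP=> E; apply/setIdP/imsetP=>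
  [[/imsetP[F cF ->]]|[F /setIdP[cF nF] ->]].
  by rewrite pcentralJ // => nF; exists F => //; apply/setIdP.
by rewrite mem_conj_chain pcentralJ.
Qed.

Lemma centsJ c P x :
  x \in G -> cents (conj_chain c x) (P :^ x)%G = conj_chain (cents c P) x.
Proof.
have CJ E : 'C_(P :^ x)(E :^ x)%G = ('C_P(E) :^ x)%G.
  by apply: val_inj; rewrite /= centJ conjIg.
move=> Gx; apply/setP=> K; apply/centsP/imsetP=> [[_ [/imsetP[E cE ->] nE ->]]|].
  exists 'C_P(E)%G; last by rewrite -CJ.
  by rewrite mem_cents // -(pcentralJ _ Gx).
case=> _ /centsP[E [cE nE ->]] ->; exists (E :^ x)%G.
by rewrite mem_conj_chain pcentralJ // -CJ.
Qed.

Lemma OmegaJ P x : Omega (P :^ x)%G = (Omega P :^ x)%G.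
Proof. by apply: val_inj; rewrite /= centerJ OhmJ. Qed.

Lemma pcentrals_sub c : pcentrals c \subset c.
Proof. by apply/subsetP=> E /setIdP[]. Qed.

Lemma pcentralsS c d : c \subset d -> pcentrals c \subset pcentrals d.
Proof.
move=> /subsetP scd; apply/subsetP=> E; rewrite !inE => /andP[cE ->].
by rewrite scd.
Qed.

Lemma centsS c d P : c \subset d -> cents c P \subset cents d P.
Proof.
move=> /subsetP scd; apply/subsetP=> _ /centsP[E [cE nE ->]].
by rewrite mem_cents ?scd.
Qed.

(** * Adapted chains when nonabelian Sylow subgroups have the required structure *)

Hypotheses (p_pr : prime p) (pG : p %| #|G|).
Hypothesis SylowAbelem : forall P, p.-Sylow(G) P -> ~~ abelian P ->
  exists A : {group gT},
    [/\ p.-abelem A, A \subset P, #|P : A| = p & logn p #|P : 'Z(P)| <= 3].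

Lemma conj_chain_id c h :
  {in c, forall E : {group gT}, E :^ h = E} -> conj_chain c h = c.
Proof.
move=> fix_h; rewrite -[RHS]imset_id; apply: eq_in_imset => E cE.
by apply: val_inj; apply: fix_h.
Qed.

Lemma Ap_chains_sub c d :
  d \in Ap_chains G p -> c \subset d -> c != finset.set0 -> c \in Ap_chains G p.
Proof.
move=> /Ap_chainsP[sd _ td] /subsetP scd /set0Pn c0; apply/Ap_chainsP.
by split=> // [E /scd/sd | E F /scd dE /scd dF] //; apply: td.
Qed.

Lemma Omega_Ap P : p.-Sylow(G) P -> Omega P \in Ap G p.
Proof.
move=> sylP; have [sPG pP _] := and3P sylP.
rewrite !inE /= (subset_trans (Ohm_sub _ _)) ?(subset_trans (center_sub P)) //=.
rewrite Ohm1_abelem ?center_abelian ?(pgroupS (center_sub P)) //=.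
rewrite Ohm1_eq1 center_nil_eq1 ?(pgroup_nil pP) //.
rewrite -rank_gt0 (rank_pgroup pP) (p_rank_Sylow sylP) p_rank_gt0.
by rewrite mem_primes p_pr cardG_gt0.
Qed.

Section Adapted.
Variables (c : {set {group gT}}) (P : {group gT}).
Hypotheses (chc : c \in Ap_chains G p) (adP : adapted c P).

Let sylP : p.-Sylow(G) P. Proof. by case/adaptedP: adP. Qed.
Let pP : p.-group P. Proof. exact: pHall_pgroup sylP. Qed.

Lemma chain_abelem E : E \in c -> p.-abelem E.
Proof. by case/Ap_chainsP: chc => sc _ _ /sc; rewrite !inE => /andP[/andP[]]. Qed.

(** [E] is a normal p-subgroup of ['C_G(E)], hence lies in its Sylow subgroup ['C_P(E)]. *)
Lemma chain_sub_Sylow E : E \in c -> E \subset P.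
Proof.
move=> cE; have abE := chain_abelem cE.
have sEG : E \subset G.
  by case/Ap_chainsP: chc => sc _ _; have := sc _ cE; rewrite !inE => /andP[/andP[]].
have [_ /(_ E cE) sylC] := adaptedP _ _ adP.
apply: subset_trans (subsetIl P 'C(E)); apply: subset_trans (pcore_sub_Hall sylC).
rewrite pcore_max ?(abelem_pgroup abE) // /normal subsetI sEG.
by rewrite (subset_trans (subsetIr _ _) (cent_sub _)) andbT; apply: abelem_abelian abE.
Qed.

Lemma chain_cents E F : E \in c -> F \in c -> E \subset 'C(F).
Proof.
move=> cE cF; case/Ap_chainsP: chc => _ _ /(_ E F cE cF)/orP[sEF | sFE].
  exact: subset_trans sEF (abelem_abelian (chain_abelem cF)).
by rewrite centsC; apply: subset_trans sFE (abelem_abelian (chain_abelem cE)).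
Qed.

Lemma pcentralE E : E \in c -> pcentral E = (P \subset 'C(E)).
Proof.
move=> cE; have [_ /(_ E cE) sylC] := adaptedP _ _ adP.
rewrite /pcentral -(card_Hall sylC) -(card_Hall sylP).
apply/idP/idP=> [/eqP eqC | cEP]; last by rewrite /= (setIidPl cEP).
by apply/setIidPl/eqP; rewrite eqEcard subsetIl eqC /=.
Qed.

Lemma noncentral_abelem_max E : E \in c -> ~~ pcentral E ->
  ~~ abelian P /\ exists A : {group gT},
    [/\ p.-abelem A, A \subset P, #|P : A| = p & logn p #|P : 'Z(P)| <= 3].
Proof.
move=> cE; rewrite pcentralE // => ncE; suff nab : ~~ abelian P.
  by split=> //; apply: SylowAbelem.
by apply: contra ncE => cPP; rewrite (subset_trans cPP) // centS ?chain_sub_Sylow.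
Qed.

Lemma noncentral_cent_abelem E : E \in c -> ~~ pcentral E -> p.-abelem 'C_P(E).
Proof.
move=> cE ncE; have [nab [A [abA sAP iA _]]] := noncentral_abelem_max cE ncE.
rewrite pcentralE // in ncE.
exact: (abelem_cent p_pr pP abA sAP iA nab (chain_abelem cE) (chain_sub_Sylow cE) ncE).
Qed.

(** For [E \subset F], either both lie in [A] and both centralisers are [A], or neither does and
    ['Z(P) * E \subset 'Z(P) * F] meets the reverse inclusion. *)
Lemma noncentral_cent_eq E F :
  E \in c -> F \in c -> ~~ pcentral E -> ~~ pcentral F -> 'C_P(E) = 'C_P(F).
Proof.
move=> cE cF; wlog sEF: E F cE cF / E \subset F => [IH ncE ncF|].
  case/Ap_chainsP: chc => _ _ /(_ E F cE cF)/orP[] sub; first exact: IH.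
  by symmetry; apply: IH.
move=> ncE ncF; have [nab [A [abA sAP iA _]]] := noncentral_abelem_max cE ncE.
have [sEP sFP] := (chain_sub_Sylow cE, chain_sub_Sylow cF).
have [cEE cFF] := (abelem_abelian (chain_abelem cE), abelem_abelian (chain_abelem cF)).
have [sFA | nFA] := boolP (F \subset A).
  rewrite !(abelem_max_cent_id p_pr abA sAP iA) -?pcentralE //.
  exact: subset_trans sEF sFA.
(* The mixed case is impossible: [E] would lie in ['C_A(F) = 'Z(P)]. *)
have [sEA | nEA] := boolP (E \subset A).
  case/negP: ncE; rewrite pcentralE // centsC.
  apply: (subset_trans _ (subsetIr P 'C(P))); rewrite -/'Z(P).
  rewrite -(abelem_max_cap_cent p_pr pP abA sAP iA nab sFP nFA) subsetI sEA.
  exact: subset_trans sEF cFF.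
apply/eqP; rewrite eqEsubset [X in _ && X]setIS ?centS // andbT.
by rewrite !(abelem_max_cent_mul p_pr pP abA sAP iA) // mulgS.
Qed.

Lemma pcentral_sub_Omega E : E \in c -> pcentral E -> E \subset Omega P.
Proof.
move=> cE; rewrite pcentralE // => cEP.
by rewrite -(Ohm1_id (chain_abelem cE)) OhmS // subsetI chain_sub_Sylow // centsC.
Qed.

Lemma Omega_sub_cent E : E \in c -> Omega P \subset 'C_P(E).
Proof.
move=> cE; apply: subset_trans (Ohm_sub _ _) _.
by rewrite setIS // centS ?chain_sub_Sylow.
Qed.

Lemma cents_Ap K : K \in cents c P -> K \in Ap G p.
Proof.
case/centsP=> E [cE ncE ->]; rewrite !inE /= noncentral_cent_abelem // andbT.
rewrite subIset ?(pHall_sub sylP) //=.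
have: E \in Ap G p by case/Ap_chainsP: chc => sc _ _; apply: sc.
rewrite !inE => /andP[_]; apply: contra => /eqP C1; rewrite -subG1 -C1.
by rewrite subsetI chain_sub_Sylow // chain_cents.
Qed.

(** By symmetry in [K] and [L], [cents c P] has at most one element. *)
Lemma cents_total (K L : {group gT}) : K \in cents c P -> L \in cents c P -> K \subset L.
Proof.
case/centsP=> E [cE ncE ->] /centsP[F [cF ncF ->]] /=.
by rewrite (noncentral_cent_eq cE cF).
Qed.

Lemma chain_sub_cents E (K : {group gT}) : E \in c -> K \in cents c P -> E \subset K.
Proof.
move=> cE /centsP[F [cF _ ->]].
by rewrite subsetI chain_sub_Sylow // chain_cents.
Qed.

Lemma add_cents_chain : c :|: cents c P \in Ap_chains G p.
Proof.
have [sc [E cE] tc] := Ap_chainsP _ chc; apply/Ap_chainsP; split.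
- by move=> F /setUP[/sc | /cents_Ap].
- by exists E; rewrite inE cE.
move=> F K /setUP[cF | cF] /setUP[cK | cK]; first exact: tc.
- by rewrite (chain_sub_cents cF).
- by rewrite (chain_sub_cents cK) ?orbT.
by rewrite cents_total.
Qed.

(** [Omega P] contains the p-central members and lies in the centralisers of the others. *)
Lemma add_Omega_chain :
  Omega P |: (pcentrals c :|: cents c P) \in Ap_chains G p.
Proof.
have [sc _ tc] := Ap_chainsP _ chc.
have tO F : F \in pcentrals c :|: cents c P -> (F \subset Omega P) || (Omega P \subset F).
  case/setUP=> [/setIdP[cF cenF] | /centsP[E [cE _ ->]]].
    by rewrite pcentral_sub_Omega.
  by rewrite Omega_sub_cent ?orbT.
apply/Ap_chainsP; split.
- by move=> F /setU1P[-> | /setUP[/setIdP[/sc] | /cents_Ap]] //; apply: Omega_Ap.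
- by exists (Omega P); rewrite setU11.
have [_ _ tg] := Ap_chainsP _ add_cents_chain.
have sub F : F \in pcentrals c :|: cents c P -> F \in c :|: cents c P.
  by rewrite !inE => /orP[/andP[-> //] | ->]; rewrite orbT.
move=> F K /setU1P[-> | gF] /setU1P[-> | gK]; rewrite ?subxx ?tO //.
  by rewrite orbC tO.
by apply: tg; apply: sub.
Qed.

Lemma pcentrals_cents_neq0 : pcentrals c :|: cents c P != finset.set0.
Proof.
have [_ [E cE] _] := Ap_chainsP _ chc; apply/set0Pn.
have [cenE | ncE] := boolP (pcentral E); first by exists E; rewrite !inE cE cenE.
by exists 'C_P(E)%G; rewrite inE mem_cents ?orbT.
Qed.

End Adapted.

(** * Comparison of two Sylow subgroups adapted to one chain *)

Lemma chain_max c : c \in Ap_chains G p ->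
  exists2 F : {group gT}, F \in c & {in c, forall E : {group gT}, E \subset F}.
Proof.
case/Ap_chainsP=> _ [E0 cE0] tc.
have [F cF maxF] := arg_maxnP (fun E : {group gT} => #|E|) cE0.
exists F => // E cE; have /orP[//|sFE] := tc _ _ cE cF.
by have /eqP-> : F == E :> {set gT} by rewrite eqEcard sFE; apply: maxF.
Qed.

(** For the largest member [F], Sylow's theorem in ['C_G(F)] gives [h], which fixes every member of
    [c]. If some member is not p-central, neither is [F], and ['C_P(F)] is the only element of
    [cents c P]. *)
Lemma adapted_conj_cents c P Q :
    c \in Ap_chains G p -> adapted c P -> adapted c Q ->
  exists2 h, h \in G & {in c, forall E : {group gT}, E :^ h = E} /\
    cents c Q = conj_chain (cents c P) h.
Proof.
move=> chc adP adQ; have [F cF maxF] := chain_max chc.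
have [_ /(_ F cF) sylP] := adaptedP _ _ adP.
have [_ /(_ F cF) sylQ] := adaptedP _ _ adQ.
have [h /setIP[Gh cFh] defC] := Sylow_trans sylP sylQ; exists h => //.
have fixh : {in c, forall E : {group gT}, E :^ h = E}.
  move=> E cE; apply/normP; apply: subsetP cFh.
  exact: subset_trans (centS (maxF E cE)) (cent_sub E).
split=> //; rewrite -centsJ // (conj_chain_id fixh).
have adP' : adapted c (P :^ h)%G by rewrite -(conj_chain_id fixh) adaptedJ.
have eqC : 'C_(P :^ h)(F) = 'C_Q(F).
  by rewrite defC conjIg -centJ (fixh F cF).
apply: eq_in_imset => E /setDP[cE]; rewrite inE cE /= => ncE.
have ncF : ~~ pcentral F by apply: contra ncE; apply: pcentral_sub (maxF E cE).
apply: val_inj => /=.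
rewrite (noncentral_cent_eq chc adQ cE cF) //.
by rewrite -eqC (noncentral_cent_eq chc adP' cE cF).
Qed.

Lemma adapted_conj_Omega c P Q :
    c \in Ap_chains G p -> adapted c P -> adapted c Q ->
  exists2 h, h \in G &
    [/\ conj_chain (pcentrals c) h = pcentrals c,
        cents c Q = conj_chain (cents c P) h & Omega Q = (Omega P :^ h)%G].
Proof.
(* Conjugating [P] by the element of the previous lemma makes the two sets of centralisers equal. *)
move=> chc; wlog eqPQ: P / cents c P = cents c Q => [IH adP adQ|adP adQ].
  have [h Gh [fixh eqQ]] := adapted_conj_cents chc adP adQ.
  have adP' : adapted c (P :^ h)%G by rewrite -(conj_chain_id fixh) adaptedJ.
  have eqP' : cents c (P :^ h)%G = cents c Q.
    by rewrite eqQ -centsJ // (conj_chain_id fixh).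
  have [k Gk [fixk eqk eqO]] := IH _ eqP' adP' adQ.
  exists (h * k); first exact: groupM.
  have conjM d : conj_chain d (h * k) = conj_chain (conj_chain d h) k.
    by rewrite !conj_chainE actM.
  rewrite !conjM -(centsJ _ _ Gh) (conj_chain_id fixh) eqk; split=> //.
    by rewrite (@conj_chain_id (pcentrals c) h) // => E /setIdP[/fixh].
  by rewrite eqO OmegaJ; apply: val_inj; rewrite /= conjsgM.
(* [C] fixes the p-central members, and every Sylow subgroup adapted to [c] lies in [C]. *)
pose C := 'C_G(\bigcup_(E in pcentrals c) E)%G.
have fixC h : h \in C -> conj_chain (pcentrals c) h = pcentrals c.
  case/setIP=> _ cenh; apply: conj_chain_id => E cE; apply/normP.
  by apply: (subsetP (cent_sub E)); apply: (subsetP (centS (bigcup_sup E cE))).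
have sylC R : adapted c R -> p.-Sylow(C) R.
  move=> adR; have [sylR _] := adaptedP _ _ adR.
  apply: (pHall_subl _ _ sylR); rewrite ?subsetIl // subsetI (pHall_sub sylR) /= centsC.
  by apply/bigcupsP=> E /setIdP[cE]; rewrite (pcentralE adR) // centsC.
(* With no centraliser to preserve, any conjugation in [C] from [P] to [Q] will do. Otherwise [h]
   must also normalise ['C_P(F)], and only the centers are matched. *)
have [eq0 | [K /centsP[F [cF ncF _]]]] := set_0Vmem (cents c P).
  have [h Ch defQ] := Sylow_trans (sylC P adP) (sylC Q adQ).
  exists h; first by case/setIP: Ch.
  rewrite fixC // -eqPQ eq0 /conj_chain imset0; split=> //.
  by rewrite -OmegaJ; congr Omega; apply: val_inj.
have [nab [A [abA sAP iA iZ]]] := noncentral_abelem_max chc adP cF ncF.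
have eqC : 'C_Q(F) = 'C_P(F).
  have : 'C_P(F)%G \in cents c Q by rewrite -eqPQ mem_cents.
  by case/centsP=> E [cE ncE /(congr1 val)/= ->]; apply: (noncentral_cent_eq chc adQ).
have sylS : p.-Sylow('C_C(F)) 'C_P(F).
  have [_ /(_ F cF)] := adaptedP _ _ adP; apply: pHall_subl.
    by rewrite setSI // (pHall_sub (sylC P adP)).
  by rewrite setSI // subsetIl.
have ncP : ~~ (P \subset 'C(F)) by rewrite -(pcentralE adP).
have [h /setIP[Ch nSh] eqZ] := conj_center_Sylow p_pr (sylC P adP) (sylC Q adQ)
  abA sAP iA nab iZ (chain_abelem chc cF) (chain_sub_Sylow chc adP cF) ncP sylS eqC.
exists h; first by case/setIP: Ch.
split; [exact: fixC | | by apply: val_inj; rewrite /= eqZ OhmJ].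
rewrite -eqPQ conj_chain_id // => _ /centsP[E [cE ncE ->]].
by apply/normP; rewrite /= (noncentral_cent_eq chc adP cE cF).
Qed.

(** * The fence on the orbit poset and the theorem *)

Lemma contractible_Ap_orbit_space : contractible (Ap_orbit_space G p).
Proof.
have [f1 h1 f1P] : exists2 f : ApOrb G p -> ApOrb G p,
    {homo f : O1 O2 / ApOrb_le O1 O2} &
    forall O c P, c \in val O -> adapted c P -> c :|: cents c P \in val (f O).
  apply: (orbit_map (g := fun c P => c :|: cents c P)) => [c P x Gx | | c P Q chc adP adQ |].
  - by rewrite centsJ // conj_chainU.
  - exact: add_cents_chain.
  - have [h Gh [fixh ->]] := adapted_conj_cents chc adP adQ.
    by exists h; rewrite // conj_chainU (conj_chain_id fixh).
  by move=> c d P scd; rewrite setUSS ?centsS.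
have [f2 h2 f2P] : exists2 f : ApOrb G p -> ApOrb G p,
    {homo f : O1 O2 / ApOrb_le O1 O2} &
    forall O c P, c \in val O -> adapted c P ->
      pcentrals c :|: cents c P \in val (f O).
  apply: (orbit_map (g := fun c P => pcentrals c :|: cents c P))
    => [c P x Gx | c P chc adP | c P Q chc adP adQ |].
  - by rewrite pcentralsJ // centsJ // conj_chainU.
  - apply: Ap_chains_sub (add_cents_chain chc adP) _ (pcentrals_cents_neq0 P chc).
    by rewrite setSU // pcentrals_sub.
  - have [h Gh [fixh eqh _]] := adapted_conj_Omega chc adP adQ.
    by exists h; rewrite // conj_chainU fixh eqh.
  by move=> c d P scd; rewrite setUSS ?centsS ?pcentralsS.
have [f3 h3 f3P] : exists2 f : ApOrb G p -> ApOrb G p,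
    {homo f : O1 O2 / ApOrb_le O1 O2} &
    forall O c P, c \in val O -> adapted c P ->
      Omega P |: (pcentrals c :|: cents c P) \in val (f O).
  apply: (orbit_map (g := fun c P => Omega P |: (pcentrals c :|: cents c P)))
    => [c P x Gx | | c P Q chc adP adQ |].
  - by rewrite pcentralsJ // centsJ // OmegaJ !conj_chainU /conj_chain imset_set1.
  - exact: add_Omega_chain.
  - have [h Gh [fixh eqh eqO]] := adapted_conj_Omega chc adP adQ.
    by exists h; rewrite // !conj_chainU fixh eqh eqO /conj_chain imset_set1.
  by move=> c d P scd; rewrite setUS // setUSS ?centsS ?pcentralsS.
(* The end of the fence is a single orbit, as all the [Omega P] are conjugate. *)
have [P0 sylP0] := Sylow_exists p G.
have ch0 : [set Omega P0] \in Ap_chains G p.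
  apply/Ap_chainsP; split.
  - by move=> E /set1P->; apply: Omega_Ap.
  - by exists (Omega P0); rewrite set11.
  by move=> E F /set1P-> /set1P->; rewrite subxx.
have hO0 : chain_orbit G [set Omega P0] \in Ap_orbits G p by rewrite imset_f.
pose O0 : ApOrb G p := @exist _ (fun X => X \in Ap_orbits G p) _ hO0.
have rep (R : ApOrb G p -> Prop) :
    (forall O c P, c \in val O -> adapted c P -> R O) -> forall O, R O.
  move=> RP O; have [c Oc] := ApOrb_has_mem O.
  have [chc _] := ApOrb_memE Oc; have [P adP] := exists_adapted chc.
  exact: RP Oc adP.
apply: (contractible_fence (x0 := O0) ApOrb_le_refl ApOrb_le_trans h1 h2 h3);
  apply: rep => O c P Oc adP; apply/ApOrb_leP.
- by exists c, (c :|: cents c P); split; rewrite ?f1P ?subsetUl.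
- exists (pcentrals c :|: cents c P), (c :|: cents c P).
  by split; rewrite ?f1P ?f2P ?setSU ?pcentrals_sub.
- exists (pcentrals c :|: cents c P), (Omega P |: (pcentrals c :|: cents c P)).
  by split; rewrite ?f2P ?f3P ?subsetUr.
exists [set Omega P], (Omega P |: (pcentrals c :|: cents c P)).
split; rewrite ?f3P ?subsetUl //=.
have [/(Sylow_trans sylP0)[x Gx defP] _] := adaptedP _ _ adP.
apply/imsetP; exists x => //; rewrite /conj_chain imset_set1 -OmegaJ.
by congr [set Omega _]; apply: val_inj.
Qed.

End OrbitMaps.

Theorem theorem5p16 (gT : finGroupType) (G P : {group gT}) (p : nat) :
  prime p -> p %| #|G| -> P \in ('Syl_p(G))%g ->
  p_rank p G - p_rank p ('Ohm_1('Z(P)))%g <= 2 ->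
  logn p #|P| - 1 <= p_rank p G ->
  contractible (Ap_orbit_space G p).
Proof.
move=> p_pr pG; rewrite inE => sylP rZ rP.
apply: contractible_Ap_orbit_space => // Q sylQ nabQ.
(* The rank bounds, given for [P], pass to each Sylow subgroup [Q] by conjugation. *)
have [x Gx defQ] := Sylow_trans sylP sylQ.
apply: abelem_max_of_rank sylQ nabQ _ _ => //.
  by rewrite defQ centerJ OhmJ p_rankJ.
by rewrite defQ cardJg.
Qed.
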